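(* Let $D=(V,A)$ be an acyclic digraph with $n=|V|$, and let $g:V\to[1,n]$ be an acyclic ordering of $D$ satisfying the equality $$\langle e_D,g\rangle=\frac12\,\langle e_D,e_D\rangle .$$ Then $D$ is the comparability digraph of a poset of dimension at most two, the function $f:=n+1-g+e_D$ (i.e. $f(x)=n+1-g(x)+e_D(x)$ for $x\in V$) is a linear extension of $D$, and $D=f\cap g$.
   Context: A digraph $D=(V,A)$ consists of a nonempty finite set $V$ of vertices and a set $A$ of ordered pairs of distinct vertices, called arcs (so there are no loops and no multiple arcs). $D$ is acyclic if it has no directed cycle. For $x\in V$ put $N^+(x)=\{z\in V:(x,z)\in A\}$, $N^-(x)=\{z\in V:(z,x)\in A\}$ and $e_D(x)=|N^-(x)|-|N^+(x)|$ (an integer). The interval $[1,n]$ denotes $\{1,2,\dots,n\}$. An acyclic ordering of $D$ is a one-to-one map $g:V\to[1,|V|]$ such that for all $x,y\in V$, $(x,y)\in A$ implies $g(x)<g(y)$. For functions $u,v:V\to\mathbb{Z}$, $\langle u,v\rangle=\sum_{x\in V}u(x)v(x)$. A poset $P=(V,<)$ is a set $V$ with an irreflexive, antisymmetric and transitive relation $<$. Its comparability digraph $D(P)=(V,A)$ has $(x,y)\in A$ if and only if $x<y$. A linear extension of $P$ is an acyclic ordering of $D(P)$; a linear extension of the digraph $D$ means an acyclic ordering of $D$. For linear extensions $f,g$ of $P$, one writes $P=f\cap g$ if for all $x,y\in V$: $x<y$ if and only if $f(x)<f(y)$ and $g(x)<g(y)$. Likewise, $D=f\cap g$ means that for all $x,y\in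 V$: $(x,y)\in A$ if and only if $f(x)<f(y)$ and $g(x)<g(y)$. $P$ has dimension two if there are two distinct linear extensions $f,g$ of $P$ with $P=f\cap g$; $P$ has dimension at most two if it is a total order or has dimension two, i.e. if there are linear extensions $f,g$ (not necessarily distinct) with $P=f\cap g$. *)

(* Defs.v *)
From mathcomp Require Import all_boot all_order all_algebra.
Set Implicit Arguments.
Unset Strict Implicit.
Unset Printing Implicit Defensive.
Import Order.TTheory GRing.Theory Num.Theory.
Local Open Scope ring_scope.

Record digraph (V : finType) := Digraph {
  arc :> rel V;
  arc_irr : irreflexive arc }.

Record poset (V : finType) := Poset {
  plt :> rel V;
  plt_irr : irreflexive plt;
  plt_anti : antisymmetric plt;
  plt_trans : transitive plt }.

Section Definitions.
Variable V : finType.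
Implicit Types (D : digraph V) (P : poset V) (u v f g : V -> int).

(* [ucycle D c] accepts the empty sequence, which is not a directed cycle. *)
Definition acyclic D : Prop := forall c : seq V, ucycle D c -> c = [::].

Definition outN D (x : V) : {set V} := [set z | D x z].
Definition inN D (x : V) : {set V} := [set z | D z x].

Definition excess D (x : V) : int := #|inN D x|%:Z - #|outN D x|%:Z.

Definition inner u v : int := \sum_(x : V) u x * v x.

(* Orderings are integer-valued, so that they can be added to [excess D];
   the codomain [1, #|V|] is therefore a separate condition. *)
Definition acyclic_ordering D g : Prop :=
  [/\ injective g,
      forall x, 1 <= g x <= #|V|%:Z
    & forall x y, D x y -> g x < g y].

Definition is_meet (r : rel V) f g : Prop :=
  forall x y, r x y <-> f x < f y /\ g x < g y.

Definition comparability P : digraph V := Digraph (plt_irr P).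

Definition linear_extension P g : Prop := acyclic_ordering (comparability P) g.

Definition total_poset P : Prop := forall x y : V, x <> y -> P x y \/ P y x.

Definition dimension_two P : Prop :=
  exists f g, [/\ linear_extension P f, linear_extension P g,
                  ~ (f =1 g) & is_meet P f g].

Definition dimension_le2 P : Prop := total_poset P \/ dimension_two P.

End Definitions.

(* Main.v *)
Require Import Defs.
From mathcomp Require Import all_boot all_order all_algebra.
From mathcomp Require Import zify ring lra.
Set Implicit Arguments.
Unset Strict Implicit.
Unset Printing Implicit Defensive.
Import Order.TTheory GRing.Theory Num.Theory.
Local Open Scope ring_scope.

(** The equality says that [g - e], with [e := excess D], has the same sum of
    squares as [g].  Now [g x - 1] is the number of vertices that [g] places
    before [x], so [g] is, up to a shift, the score function (number of
    in-neighbours) of the transitive tournament [L] that has an arc from [y] to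
    [x] when [g y < g x].  Reversing in [L] exactly the arcs of [D] gives another
    tournament [T], whose score function is [g - 1 - e]
    ([score_reversal]).  All tournaments on [V] have the same total score, so
    [e] sums to 0 and [T] and [L] also have the same sum of squared scores.

    Among tournaments on a given vertex set, transitive ones are recognised by
    the sum of the squares of their scores: the number of cyclic triples
    depends only on that sum ([cyclic_triples_eq]), and a tournament is
    transitive when it has no cyclic triple.  Hence the equality forces [T] to
    be transitive.  In a transitive tournament an arc from [y] to [x] is the
    same thing as a strict inequality of scores, so [f = n - score T] is an
    ordering of [V], opposite to [T].  Finally [D x y] holds exactly when [x]
    precedes [y] in [L] and [y] precedes [x] in [T], which is [D = f \cap g];
    an intersection of two orders is a poset of dimension at most two. *)

(** * Scores and cyclic triples in tournaments *)

Section Tournament.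
Variable V : finType.
Implicit Types (r : rel V) (x y z : V).

(** Booleans are counted as 0 and 1; the case [x = y] gives irreflexivity. *)
Definition tournament r : Prop := forall x y, (r x y + r y x = (x != y))%N.

Definition score r x : nat := (\sum_y r y x)%N.

Definition transitive_triples r : nat :=
  (\sum_x \sum_y \sum_z r y x * r z x * r y z)%N.

Definition cyclic_triples r : nat :=
  (\sum_x \sum_y \sum_z r y x * r x z * r z y)%N.

Lemma tournament_irr r x : tournament r -> r x x = false.
Proof. by move/(_ x x); rewrite eqxx; case: (r x x). Qed.

Lemma tournament_asym r x y : tournament r -> r x y -> r y x = false.
Proof. by move/(_ x y); case: (r x y); case: (r y x); case: eqP. Qed.

Lemma tournament_total r x y : tournament r -> x != y -> r x y || r y x.
Proof. by move=> /(_ x y) + xy; rewrite xy; case: (r x y); case: (r y x). Qed.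

Lemma sum_score r : tournament r ->
  ((\sum_x score r x).*2 = \sum_(x : V) \sum_(y : V) (y != x))%N.
Proof.
move=> rT; rewrite -addnn /score {1}exchange_big /= -big_split /=.
apply: eq_bigr => x _; rewrite -big_split /=.
by apply: eq_bigr => y _; rewrite rT eq_sym.
Qed.

(** Ordered pairs of distinct in-neighbours of [x] are joined by exactly one
    arc, so each transitive triple is counted twice on the left. *)
Lemma sum_score_sqr r : tournament r ->
  (\sum_x score r x ^ 2 = \sum_x score r x + (transitive_triples r).*2)%N.
Proof.
move=> rT.
have -> : (transitive_triples r).*2 =
    (\sum_x \sum_y \sum_z (r y x * r z x * r y z + r y x * r z x * r z y))%N.
  rewrite -addnn /transitive_triples -big_split /=; apply: eq_bigr => x _.
  rewrite [X in (_ + X)%N]exchange_big -big_split /=; apply: eq_bigr => y _.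
  rewrite -big_split /=; apply: eq_bigr => z _.
  by rewrite [(r z x * r y x)%N]mulnC.
rewrite -big_split /=; apply: eq_bigr => x _.
rewrite -mulnn {1 2}/score big_distrlr /= /score -big_split /=.
apply: eq_bigr => y _.
have -> : (nat_of_bool (r y x) = \sum_z (z == y) * r y x)%N.
  by rewrite (bigD1 y) //= eqxx mul1n big1 ?addn0 // => z /negbTE->.
rewrite -big_split /=; apply: eq_bigr => z _.
have -> : (\sum_z0 (z0 == y) * r y x = r y x)%N.
  by rewrite (bigD1 y) //= eqxx mul1n big1 ?addn0 // => w /negbTE->.
rewrite -mulnDr rT; have [->|] := eqVneq y z; first by case: (r z x).
by case: (r y x); case: (r z x).
Qed.

(** The left side counts the paths [y -> x -> z]; in a tournament such a path
    closes up to a transitive or to a cyclic triple. *)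
Lemma sum_score_outdegree r : tournament r ->
  (\sum_x score r x * (\sum_z r x z)
     = transitive_triples r + cyclic_triples r)%N.
Proof.
move=> rT.
have -> : transitive_triples r =
    (\sum_x \sum_y \sum_z r y x * r x z * r y z)%N.
  rewrite /transitive_triples exchange_big /= [RHS]exchange_big /=.
  apply: eq_bigr => y _; rewrite [RHS]exchange_big /=.
  apply: eq_bigr => z _; apply: eq_bigr => x _.
  ring.
rewrite /cyclic_triples -big_split /=; apply: eq_bigr => x _.
rewrite /score big_distrlr /= -big_split /=; apply: eq_bigr => y _.
rewrite -big_split /=; apply: eq_bigr => z _.
rewrite -mulnDr rT; have [<-|] := eqVneq y z; last by rewrite muln1.
by case ryx: (r y x) => //; rewrite (tournament_asym rT ryx).
Qed.

Lemma score_outdegree r x : tournament r ->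
  (score r x + \sum_z r x z + 1 = #|V|)%N.
Proof.
move=> rT; rewrite /score -big_split /=.
under eq_bigr => y _ do rewrite rT.
rewrite -sum1_card (bigD1 x) //= [RHS](bigD1 x) //= eqxx add0n [RHS]addnC.
by congr addn; apply: eq_bigr => y ->.
Qed.

(** The sum of the scores is the number of pairs of vertices; together with the
    sum of squares it fixes the number of transitive triples, and then
    [sum_score_outdegree], with outdegree [#|V| - 1 - score], fixes the number
    of cyclic ones. *)
Lemma cyclic_triples_eq r r' : tournament r -> tournament r' ->
  (\sum_x score r x ^ 2 = \sum_x score r' x ^ 2)%N ->
  cyclic_triples r = cyclic_triples r'.
Proof.
move=> rT rT' sqE.
have key q : tournament q ->
    (\sum_x score q x ^ 2 + (transitive_triples q + cyclic_triples q)
       + \sum_x score q x = #|V| * \sum_x score q x)%N.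
  move=> qT; rewrite -sum_score_outdegree // -!big_split /= big_distrr /=.
  by apply: eq_bigr => x _; rewrite -(score_outdegree x qT); ring.
have := key _ rT; have := key _ rT'.
have := sum_score_sqr rT; have := sum_score_sqr rT'.
have : (\sum_x score r x = \sum_x score r' x)%N.
  by apply: double_inj; rewrite !sum_score.
by rewrite sqE => ->; lia.
Qed.

(** If [r x y] and [r y z], either [r x z] or these arcs close to a cycle. *)
Lemma cyclic_triples_eq0 r : tournament r ->
  (cyclic_triples r == 0%N) <-> transitive r.
Proof.
move=> rT; split=> [|rtr].
  rewrite sum_nat_eq0 => /forallP C y x z rxy ryz.
  move: (C y); rewrite sum_nat_eq0 => /forallP /(_ x).
  rewrite sum_nat_eq0 => /forallP /(_ z); rewrite rxy ryz /= => rzx.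
  have xz : x != z.
    by apply: contraTneq ryz => <-; rewrite (tournament_asym rT rxy).
  by have := tournament_total rT xz; case: (r z x) rzx; rewrite ?orbF.
rewrite /cyclic_triples big1 // => x _; rewrite big1 // => y _.
rewrite big1 // => z _.
case ryx: (r y x) => //; case rxz: (r x z) => //.
by rewrite (tournament_asym rT (rtr _ _ _ ryx rxz)).
Qed.

(** An arc from [x] to [y] makes every in-neighbour of [x] one of [y], and [x]
    itself is an additional one. *)
Lemma score_lt r x y : tournament r -> transitive r ->
  (score r x < score r y)%N = r x y.
Proof.
move=> rT rtr.
have mono a b : r a b -> (score r a < score r b)%N.
  move=> rab; rewrite /score (bigD1 a) //= [ltnRHS](bigD1 a) //= rab.
  rewrite tournament_irr // add0n add1n ltnS; apply: leq_sum => z _.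
  by case rza: (r z a) => //; rewrite (rtr _ _ _ rza rab).
apply/idP/idP; last exact: mono.
case: (eqVneq x y) => [->|xy]; first by rewrite ltnn.
by case/orP: (tournament_total rT xy) => // /mono; lia.
Qed.

End Tournament.

(** * The tournament obtained by reversing the arcs of the digraph *)

Section Reversal.
Variables (V : finType) (D : digraph V) (g : V -> int).
Hypothesis g_ordering : acyclic_ordering D g.

Definition before : rel V := fun y x => g y < g x.

Definition reversal : rel V :=
  fun y x => if before y x then ~~ D y x else D x y.

Lemma before_tournament : tournament before.
Proof.
case: g_ordering => g_inj _ _ x y; rewrite /before -(inj_eq g_inj).
by case: ltgtP.
Qed.

Lemma reversal_tournament : tournament reversal.
Proof.
case: g_ordering => g_inj _ g_mono x y; rewrite /reversal /before.
rewrite -(inj_eq g_inj); case: ltgtP => [_|_|/g_inj->].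
- by case: (D x y).
- by case: (D y x).
- by rewrite (arc_irr D).
Qed.

Lemma arcE x y : D x y = reversal y x && (g x < g y).
Proof.
case: g_ordering => _ _ g_mono; rewrite /reversal /before.
case Dxy: (D x y); last by case: ltgtP => // _; rewrite andbF.
by have := g_mono _ _ Dxy; case: ltgtP.
Qed.

(** An injection of [V] into [[1, #|V|]] is onto, so every value below [g x]
    is taken. *)
Lemma score_before x : (score before x)%:Z = g x - 1.
Proof.
case: g_ordering => g_inj g_rng _.
have hP y : (`|g y - 1| < #|V|)%N by have := g_rng y; lia.
pose h y := Ordinal (hP y).
have h_inj : injective h.
  move=> y z /(congr1 val) /= e; apply: g_inj.
  by have := g_rng y; have := g_rng z; lia.
have h_bij : bijective h by apply: inj_card_bij; rewrite // card_ord.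
have -> : score before x = (\sum_(i < #|V|) (i < h x))%N.
  rewrite (reindex h) /=; last exact: onW_bij.
  apply: eq_bigr => y _; congr nat_of_bool; rewrite /before.
  by have := g_rng y; have := g_rng x; lia.
have -> : (\sum_(i < #|V|) (i < h x) = h x)%N.
  have hx : (h x <= #|V|)%N by apply: ltnW.
  rewrite -[RHS]card_ord -[RHS]sum1_card.
  rewrite (big_ord_widen _ (fun=> 1%N) hx) [RHS]big_mkcond.
  by apply: eq_bigr => i _; case: (i < h x)%N.
by rewrite /=; have := g_rng x; lia.
Qed.

Lemma excess_sum x : excess D x = \sum_y ((D y x)%:Z - (D x y)%:Z).
Proof.
have cardE (A : {set V}) : #|A|%:Z = \sum_y (y \in A)%:Z.
  by rewrite -sum1_card big_mkcond /= (big_morph _ PoszD erefl).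
rewrite /excess !cardE -sumrB.
by apply: eq_bigr => y _; rewrite !inE.
Qed.

(** Reversing the arcs of [D] costs [x] its in-neighbours in [D], which all
    come before it, and gives it its out-neighbours, which all come after. *)
Lemma score_reversal x :
  (score reversal x)%:Z = (score before x)%:Z - excess D x.
Proof.
case: g_ordering => _ _ g_mono.
rewrite excess_sum /score !(big_morph _ PoszD erefl) -sumrB.
apply: eq_bigr => y _; rewrite /reversal /before.
case Dyx: (D y x); case Dxy: (D x y); case: (ltgtP (g y) (g x)) => //.
all: try by move: (g_mono _ _ Dyx); lia.
all: by move: (g_mono _ _ Dxy); lia.
Qed.

Hypothesis g_eq : 2 * inner (excess D) g = inner (excess D) (excess D).

Lemma reversal_trans : transitive reversal.
Proof.
apply/(cyclic_triples_eq0 reversal_tournament).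
rewrite (cyclic_triples_eq (r' := before)).
- apply/(cyclic_triples_eq0 before_tournament) => y x z; exact: lt_trans.
- exact: reversal_tournament.
- exact: before_tournament.
have sum_excess : \sum_x excess D x = 0.
  have /(congr1 Posz) : (\sum_x score reversal x = \sum_x score before x)%N.
    apply: double_inj; rewrite !sum_score //.
      exact: before_tournament.
    exact: reversal_tournament.
  rewrite !(big_morph _ PoszD erefl).
  under eq_bigr => x _ do rewrite score_reversal.
  rewrite sumrB => /eqP; rewrite -subr_eq0 addrAC subrr sub0r oppr_eq0.
  by move/eqP.
apply/eqP; rewrite -eqz_nat !(big_morph _ PoszD erefl) -subr_eq0 -sumrB.
have E x : (score reversal x ^ 2)%N%:Z - (score before x ^ 2)%N%:Z =
    excess D x * excess D x - 2 * (excess D x * g x) + 2 * excess D x.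
  rewrite -!mulnn !PoszM score_reversal score_before; ring.
under eq_bigr => x _ do rewrite E.
rewrite big_split sumrB -!mulr_sumr /= sum_excess.
by rewrite mulr0 addr0 [X in _ - X]g_eq subrr.
Qed.

End Reversal.

(** * Posets as intersections of two orders *)

(** Dimension two asks for distinct orders; when [f] and [g] coincide, the
    intersection is that single order, which is total. *)
Lemma meet_dimension_le2 (V : finType) (D : digraph V) (f g : V -> int) :
  acyclic_ordering D f -> acyclic_ordering D g -> is_meet D f g ->
  exists P : poset V, D =2 comparability P /\ dimension_le2 P.
Proof.
move=> fO gO fg.
have anti : antisymmetric D.
  by move=> x y /andP[/fg[_ +] /fg[_ +]]; lia.
have tr : transitive D.
  move=> y x z /fg[fxy gxy] /fg[fyz gyz]; apply/fg.
  by split; [exact: lt_trans fxy fyz | exact: lt_trans gxy gyz].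
pose P := Poset (arc_irr D) anti tr.
exists P; split=> //.
case: (boolP [forall x, f x == g x]) => [/forallP fgE|/forallPn[x0 /eqP ne]].
  left=> x y xy; case: gO => g_inj _ _ /=.
  have /eqP fx := fgE x; have /eqP fy := fgE y.
  case: (ltgtP (g x) (g y)) => [lt|lt|/g_inj//].
    by left; apply/fg; rewrite fx fy.
  by right; apply/fg; rewrite fx fy.
by right; exists f, g; split=> // /(_ x0).
Qed.

Theorem theorem2 (V : finType) (V_nonempty : (0 < #|V|)%N)
    (D : digraph V) (D_acyclic : acyclic D)
    (g : V -> int) (g_ordering : acyclic_ordering D g)
    (g_eq : (inner (excess D) g)%:~R
            = 1 / 2 * (inner (excess D) (excess D))%:~R :> rat) :
  let f := fun x : V => #|V|%:Z + 1 - g x + excess D x in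
  [/\ exists P : poset V, D =2 comparability P /\ dimension_le2 P,
      acyclic_ordering D f
    & is_meet D f g].
Proof.
move=> f.
have g_eqZ : 2 * inner (excess D) g = inner (excess D) (excess D).
  apply: (@intr_inj rat); rewrite intrM g_eq; lra.
have rT := reversal_tournament g_ordering.
have rtr := reversal_trans g_ordering g_eqZ.
have fE x : f x = #|V|%:Z - (score (reversal D g) x)%:Z.
  rewrite (score_reversal g_ordering) (score_before g_ordering).
  by rewrite /f; ring.
have f_lt x y : (f x < f y) = reversal D g y x.
  rewrite -(score_lt _ _ rT rtr) !fE; lia.
have fg : is_meet D f g.
  by move=> x y; rewrite (arcE g_ordering) f_lt; split=> /andP.
have fO : acyclic_ordering D f.
  split=> [x y fxy | x | x y /fg[]//].
    apply/eqP; apply: contraT => /(tournament_total rT).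
    by rewrite -!f_lt fxy ltxx.
  by have := score_outdegree x rT; rewrite fE; lia.
by split=> //; apply: meet_dimension_le2 fO g_ordering fg.
Qed.
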